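(* Let $r,k$ be positive integers and $x$ an indeterminate. For $\tilde\nu\in\tilde\Pi_{2(r),k}$ whose unbarred entries have multiplicity given by $\boldsymbol{a}\in W_{r,k}$, let $\omega(\tilde\nu)=\frac{m(\tilde\nu)!}{|\mathfrak{S}_{\boldsymbol{a}}|}\prod_{\tilde B\in\tilde\nu}m(\tilde B|_{[\bar k]})!$, and let $\varphi:\tilde P_{r,k}(x)\to\mathrm{MP}_{r,k}(x)$ be the isomorphism of algebras with $\varphi(\mathcal{O}_{\tilde\nu})=\omega(\tilde\nu)\mathcal{X}_{\tilde\nu}$ for all $\tilde\nu\in\tilde\Pi_{2(r),k}$. Let $\tilde\pi\in\tilde\Pi_{2(r),k}$ have unbarred and barred multiplicities $\boldsymbol{a}$ and $\boldsymbol{b}$, and fix $\pi\in\Pi_{2(r)}$ with $\kappa_{\boldsymbol{a},\boldsymbol{b}}(\pi)=\tilde\pi$. Then $$\varphi(\mathcal{D}_{\tilde\pi})=\sum_{\tilde\nu\le\tilde\pi}c_{\tilde\nu,\tilde\pi}\,\omega(\tilde\nu)\,\mathcal{X}_{\tilde\nu},$$ where $c_{\tilde\nu,\tilde\pi}$ is the number of $\nu\in\Pi_{2(r)}$ with $\nu\le\pi$ and $\kappa_{\boldsymbol{a},\boldsymbol{b}}(\nu)=\tilde\nu$.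
   Context: $[r]=\{1,\dots,r\}$, $[\bar r]=\{\bar1,\dots,\bar r\}$; $\Pi_{2(r)}$ is the set of set partitions of $[r]\cup[\bar r]$. $P_r(x)$ is the $\mathbb{C}(x)$-algebra with diagram basis $\{\mathcal{L}_\pi:\pi\in\Pi_{2(r)}\}$ and product $\mathcal{L}_\pi\mathcal{L}_\nu=x^{c}\mathcal{L}_\gamma$: place the diagram of $\pi$ (top row $1,\dots,r$, bottom row $\bar1,\dots,\bar r$) above that of $\nu$, identify bottom vertex $\bar i$ of $\pi$ with top vertex $i$ of $\nu$; $\gamma$ is the resulting connectivity of the very top and very bottom, $c$ the number of components entirely in the middle. For set partitions or multiset partitions, $\nu\le\pi$ ($\nu$ is coarser than $\pi$) means $\nu$ is obtained from $\pi$ by combining blocks (multiset union for multisets); $\pi\le\pi$. The orbit basis $\{\mathcal{T}_\pi\}$ is determined by $\mathcal{L}_\pi=\sum_{\nu\le\pi}\mathcal{T}_\nu$. For $\sigma\in\mathfrak{S}_r$, $\mathcal{L}_\sigma$ is the basis element of $\{\{\sigma(1),\bar1\},\dots,\{\sigma(r),\bar r\}\}$. $W_{r,k}$ is the set of sequences of $k$ non-negative integers with sum $r$; $\mathfrak{S}_{\boldsymbol{a}}\subseteq\mathfrak{S}_r$ is the Young subgroup permuting separately the consecutive intervals of lengths $\boldsymbol{a}_1,\dots,\boldsymbol{a}_k$; $s_{\boldsymbol{a}}=\frac1{|\mathfrak{S}_{\boldsymbol{a}}|}\sum_{\sigma\in\mathfrak{S}_{\boldsymbol{a}}}\mathcal{L}_\sigma$.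 $\tilde P_{r,k}(x)=\bigoplus_{\boldsymbol{a},\boldsymbol{b}\in W_{r,k}}s_{\boldsymbol{a}}P_r(x)s_{\boldsymbol{b}}$ (external direct sum), with $(s_{\boldsymbol{a}}\varphi s_{\boldsymbol{b}})\cdot(s_{\boldsymbol{c}}\psi s_{\boldsymbol{d}})=\delta_{\boldsymbol{b},\boldsymbol{c}}s_{\boldsymbol{a}}\varphi s_{\boldsymbol{b}}\psi s_{\boldsymbol{d}}$. $\tilde\Pi_{2(r),k}$ is the set of multiset partitions (multisets of nonempty multisets, called blocks) with $r$ elements from $[k]$ and $r$ from $[\bar k]$ in total. $\kappa_{\boldsymbol{a},\boldsymbol{b}}:\Pi_{2(r)}\to\tilde\Pi_{2(r),k}$ replaces each unbarred $i$ by the index $j$ of the consecutive interval of lengths $\boldsymbol{a}_1,\dots,\boldsymbol{a}_k$ containing $i$, and each $\bar i$ by $\bar j$ with $j$ the index of the interval of lengths $\boldsymbol{b}_1,\dots,\boldsymbol{b}_k$ containing $i$. For $\tilde\pi$ with unbarred/barred multiplicities $\boldsymbol{a}$/$\boldsymbol{b}$ and any $\pi$ with $\kappa_{\boldsymbol{a},\boldsymbol{b}}(\pi)=\tilde\pi$: $\mathcal{D}_{\tilde\pi}=s_{\boldsymbol{a}}\mathcal{L}_\pi s_{\boldsymbol{b}}$ (diagram-like basis) and $\mathcal{O}_{\tilde\pi}=s_{\boldsymbol{a}}\mathcal{T}_\pi s_{\boldsymbol{b}}$ (orbit-like basis). For a multiset $\tilde S$ (of elements, or of blocks), $m(\tilde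 S)!$ is the product over distinct members of the factorials of their multiplicities ($1$ if empty). $\tilde B|_R$ keeps only the elements of $\tilde B$ in $R$; for a multiset partition, $\tilde\rho|_R$ restricts every block and discards empty results. In $\omega$ the product is over blocks with multiplicity. $\ell(\cdot)$ is the number of blocks with multiplicity; $(a)_n=a(a-1)\cdots(a-n+1)$. $\mathrm{MP}_{r,k}(x)$ is the $\mathbb{C}(x)$-algebra with (Orellana–Zabrocki orbit) basis $\{\mathcal{X}_{\tilde\pi}:\tilde\pi\in\tilde\Pi_{2(r),k}\}$ and product $\mathcal{X}_{\tilde\pi}\mathcal{X}_{\tilde\nu}=\sum_{\tilde\gamma\in\tilde\Gamma^{\tilde\pi}_{\tilde\nu}}a_{\tilde\gamma}\tilde b_{\tilde\gamma}(x)\mathcal{X}_{\tilde\gamma}$, where $\tilde\Gamma^{\tilde\pi}_{\tilde\nu}$ is the set of multiset partitions $\tilde\gamma$ with $r$ elements each from $[k]$, $[\bar k]$, $[\bar{\bar k}]$ such that $\tilde\gamma|_{[k]\cup[\bar k]}=\tilde\pi$ and $\tilde\gamma|_{[\bar k]\cup[\bar{\bar k}]}$ is $\tilde\nu$ with a bar added to every element; the index in $\mathcal{X}_{\tilde\gamma}$ means $\tilde\gamma|_{[k]\cup[\bar{\bar k}]}$ with one bar removed from each double-barred element; $\tilde b_{\tilde\gamma}(x)=(x-\ell(\tilde\gamma|_{[k]\cup[\bar{\bar k}]}))_{\ell(\beta_{\tilde\gamma})}/m(\beta_{\tilde\gamma})!$ with $\beta_{\tilde\gamma}$ the multiset of blocks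 of $\tilde\gamma$ with all elements in $[\bar k]$; and $a_{\tilde\gamma}=\prod_{\tilde S}\ell(\tilde\gamma_{\tilde S})!/m(\tilde\gamma_{\tilde S})!$ over distinct blocks $\tilde S$ of $\tilde\gamma|_{[k]\cup[\bar{\bar k}]}$, with $\tilde\gamma_{\tilde S}$ the multiset of blocks $\tilde T\in\tilde\gamma$ with $\tilde T|_{[k]\cup[\bar{\bar k}]}=\tilde S$. *)

(* Defs.v *)
From HB Require Import structures.
From mathcomp Require Import all_boot all_order all_algebra all_fingroup.
From mathcomp Require Import finmap multiset complex.
From mathcomp Require Import boolp reals.

(* Partition algebras and multiset partition algebras.                        *)
(*                                                                            *)
(* An element of a row is a pair (l, i): l is its number of bars and i its    *)
(* value, indexed from 0.  Thus [r] u [r-bar] is vtx 2 r, with (0, i)         *)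
(* unbarred and (1, i) barred, and [k] u [k-bar] u [k-bar-bar] is vtx 3 k.    *)
(* The algebras are defined over any field F with parameter x : F, and        *)
(* specialised at the end of the file to C(x) and its indeterminate.          *)

Set Implicit Arguments.
Unset Strict Implicit.
Unset Printing Implicit Defensive.

Import GRing.Theory.
Local Open Scope ring_scope.

Notation vtx h r := ('I_h * 'I_r)%type.

(* The embedding of h rows in h.+1 rows that leaves row l empty: skip ord_max *)
(* and skip ord0 place a diagram on the two upper and the two lower rows of a *)
(* stack of three, and skip 1 hits the very top and the very bottom row.      *)
Definition skip h r (l : 'I_h.+1) (v : vtx h r) : vtx h.+1 r := (lift l v.1, v.2).

Record setpart (r : nat) := SetPart {
  sp_blocks :> {set {set vtx 2 r}};
  sp_partition : partition sp_blocks [set: vtx 2 r] }.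

HB.instance Definition _ r := [isSub for @sp_blocks r].
HB.instance Definition _ r := [Finite of setpart r by <:].

(* q is obtained from p by combining blocks: G groups the blocks of p, and the *)
(* blocks of q are the unions of the groups.                                  *)
Definition coarser r (q p : setpart r) : bool :=
  [exists G : {set {set {set vtx 2 r}}},
    partition G p && (sp_blocks q == [set cover g | g in G])].

Lemma ord2P (l : 'I_2) : l = 0 \/ l = 1.
Proof. by case: l => [[|[|]]] // i; [left|right]; apply/val_inj. Qed.

Section Diagrams.
Variable r : nat.
Implicit Types p q : setpart r.

Definition same_block p (f : vtx 2 r -> vtx 3 r) (u v : vtx 3 r) : bool :=
  [exists B in sp_blocks p, (u \in f @: B) && (v \in f @: B)].

Definition stack_edge p q : rel (vtx 3 r) := fun u v =>
  same_block p (skip ord_max) u v || same_block q (skip ord0) u v.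

Definition stack_comps p q : {set {set vtx 3 r}} :=
  equivalence_partition (connect (stack_edge p q)) [set: vtx 3 r].

Definition mid_comps p q : {set {set vtx 3 r}} :=
  [set C in stack_comps p q | [forall v in C, v.1 == 1]].

Definition outer_rel p q : rel (vtx 2 r) := fun u v =>
  connect (stack_edge p q) (skip 1 u) (skip 1 v).

Lemma stack_sym p q : connect_sym (stack_edge p q).
Proof.
apply: sym_connect_sym => u v; rewrite /stack_edge /same_block.
by congr (_ || _); apply: eq_existsb => B; rewrite [X in _ && X]andbC.
Qed.

Lemma connect_stack_equiv p q : equivalence_rel (connect (stack_edge p q)).
Proof.
apply/equivalence_relP; split=> [u|u v uv w]; first exact: connect0.
exact: (same_connect (@stack_sym p q) uv).
Qed.

Lemma compose_partition p q :
  partition (equivalence_partition (outer_rel p q) [set: vtx 2 r]) [set: vtx 2 r].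
Proof.
apply: equivalence_partitionP => u v w _ _ _.
exact: (connect_stack_equiv p q (skip 1 u) (skip 1 v) (skip 1 w)).
Qed.

Definition compose p q : setpart r := SetPart (compose_partition p q).

Lemma perm_diagram_partition (s : 'S_r) :
  partition [set [set (0, s i); (1, i)] | i : 'I_r] [set: vtx 2 r].
Proof.
apply/and3P; split.
- apply/eqP/setP=> -[l i]; rewrite in_setT; apply/bigcupP.
  case: (ord2P l) => ->.
    exists [set (0, s (s^-1%g i)); (1, s^-1%g i)].
      by apply/imsetP; exists (s^-1%g i).
    by rewrite permKV !inE eqxx.
  exists [set (0, s i); (1, i)]; first by apply/imsetP; exists i.
  by rewrite !inE eqxx orbT.
- apply/trivIsetP=> _ _ /imsetP[i _ ->] /imsetP[j _ ->] nij.
  have {nij} ij : i != j by apply: contraNneq nij => ->.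
  rewrite disjoints_subset; apply/subsetP=> -[l m].
  rewrite !inE !xpair_eqE; case: (ord2P l) => -> /=.
    by rewrite !orbF => /eqP->; rewrite (inj_eq perm_inj).
  by move=> /eqP->.
- by apply/imsetP=> -[i _] /setP/(_ (1, i)); rewrite !inE eqxx orbT.
Qed.

(* {{s(0), 0-bar}, ..., {s(r-1), (r-1)-bar}} *)
Definition perm_diagram (s : 'S_r) : setpart r :=
  SetPart (perm_diagram_partition s).

End Diagrams.

(* Associativity of the diagram product.  Mapping a set partition p to the    *)
(* 0-1 matrix cst p, indexed by the labellings t (top) and b (bottom) of the  *)
(* rows by booleans, with entry 1 iff the labelling is constant on the blocks *)
(* of p, turns the product of diagrams into 2 ^ c times a matrix product.     *)
Section Labellings.
Variable r : nat.
Implicit Types (p q : setpart r) (t m b : {ffun 'I_r -> bool}).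

Definition glue2 t b (v : vtx 2 r) := if v.1 == 0 then t v.2 else b v.2.
Definition glue3 t m b (v : vtx 3 r) :=
  if v.1 == 0 then t v.2 else if v.1 == 1 then m v.2 else b v.2.

Definition cst p t b : bool :=
  [forall B in sp_blocks p, forall u in B, forall v in B, glue2 t b u == glue2 t b v].

Lemma cstP p t b :
  reflect (forall B, B \in sp_blocks p -> {in B &, forall u v, glue2 t b u = glue2 t b v})
          (cst p t b).
Proof.
apply: (iffP forall_inP) => [H B /H /forall_inP H1 u v /H1 /forall_inP H2 /H2/eqP|H B hB] //.
by apply/forall_inP=> u hu; apply/forall_inP=> v hv; apply/eqP; exact: (H B).
Qed.

Lemma glue_up t m b v : glue3 t m b (skip ord_max v) = glue2 t m v.
Proof. by case: v => l i; case: (ord2P l) => ->. Qed.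
Lemma glue_down t m b v : glue3 t m b (skip ord0 v) = glue2 m b v.
Proof. by case: v => l i; case: (ord2P l) => ->. Qed.
Lemma glue_out t m b v : glue3 t m b (skip 1 v) = glue2 t b v.
Proof. by case: v => l i; case: (ord2P l) => ->. Qed.

Lemma cst_stack p q t m b :
  cst p t m && cst q m b =
  [forall u, forall v, connect (stack_edge p q) u v ==> (glue3 t m b u == glue3 t m b v)].
Proof.
apply/andP/forallP => [[/cstP cp /cstP cq] u|H].
  apply/forallP=> v; apply/implyP=> /connectP[s]; elim: s u => [|w s IH] u /=.
    by move=> _ ->.
  case/andP=> uw /IH{}IH /IH/eqP<-; case/orP: uw.
    case/exists_inP=> B hB /andP[/imsetP[u' hu ->] /imsetP[w' hw ->]].
    by rewrite !glue_up (cp B hB u' w' hu hw).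
  case/exists_inP=> B hB /andP[/imsetP[u' hu ->] /imsetP[w' hw ->]].
  by rewrite !glue_down (cq B hB u' w' hu hw).
split; apply/cstP=> B hB u v hu hv; [rewrite -!(glue_up t m b) | rewrite -!(glue_down t m b)];
  apply/eqP; move: (H (skip ord_max u)) (H (skip ord0 u)).
  move=> /forallP/(_ (skip ord_max v))/implyP H1 _; apply: H1; apply: connect1.
  by apply/orP; left; apply/exists_inP; exists B => //; rewrite !imset_f.
move=> _ /forallP/(_ (skip ord0 v))/implyP H1; apply: H1; apply: connect1.
by apply/orP; right; apply/exists_inP; exists B => //; rewrite !imset_f.
Qed.

Lemma cst_outer p q t b :
  cst (compose p q) t b =
  [forall u, forall v, outer_rel p q u v ==> (glue2 t b u == glue2 t b v)].
Proof.
apply/cstP/forallP => [H u|H B /imsetP[w _ ->] u v].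
  apply/forallP=> v; apply/implyP=> uv; apply/eqP.
  apply: (H [set y in setT | outer_rel p q u y]); rewrite ?inE //.
    by apply/imsetP; exists u.
  exact: connect0.
rewrite !inE /= => wu wv.
have /forallP/(_ u)/implyP/(_ wu)/eqP <- := H w.
by have /forallP/(_ v)/implyP/(_ wv)/eqP <- := H w.
Qed.

Lemma outerP (v : vtx 3 r) : v.1 != 1 -> exists w, v = skip 1 w.
Proof.
case: v => l i; case: (unliftP (1 : 'I_3) l) => [l' -> _|->]; last by rewrite eqxx.
by exists (l', i).
Qed.

Lemma glue3_mid t m b v : v.1 = 1 -> glue3 t m b v = m v.2.
Proof. by rewrite /glue3 => ->. Qed.

Lemma sum_cst p q t b :
  (\sum_m (cst p t m * cst q m b) = 2 ^ #|mid_comps p q| * cst (compose p q) t b)%N.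
Proof.
transitivity #|[set m | cst p t m && cst q m b]|.
  rewrite -sum1dep_card [RHS]big_mkcond; apply: eq_bigr => m _.
  by case: (cst p _ _); case: (cst q _ _).
set e := connect (stack_edge p q).
have e_sym : symmetric e := @stack_sym r p q.
have etr : transitive e by apply: connect_trans.
pose comp v : {set vtx 3 r} := [set w in setT | e v w].
have compE v w : (w \in comp v) = e v w by rewrite !inE.
have eq_comp v w : e v w -> comp v = comp w.
  by move=> vw; apply/setP=> z; rewrite !compE; apply: (same_connect (@stack_sym r p q) vw).
have [cg|ncg] := boolP (cst _ t b); last first.
  rewrite muln0; apply/eqP; rewrite cards_eq0; apply/eqP/setP=> m; rewrite in_set0.
  apply/negbTE; rewrite inE; apply: contra ncg.
  rewrite cst_stack cst_outer => /forallP H; apply/forallP=> u; apply/forallP=> v.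
  apply/implyP=> uv; rewrite -!(glue_out t m b).
  by have /forallP/(_ (skip 1 v))/implyP/(_ uv) := H (skip 1 u).
rewrite muln1 -card_powerset.
pose phi m := [set C in mid_comps p q | [forall v in C, m v.2]].
rewrite -(@card_in_imset _ _ phi); last first.
  move=> m m'; rewrite !inE !cst_stack => /forallP H /forallP H' E.
  apply/ffunP=> i; pose v : vtx 3 r := (1, i).
  have gm : glue3 t m b v = m i by [].
  have gm' : glue3 t m' b v = m' i by [].
  have [Cm|] := boolP (comp v \in mid_comps p q); last first.
    rewrite inE negb_and; case/orP.
      by case/negP; apply/imsetP; exists v.
    case/forall_inPn=> w; rewrite compE => vw /outerP[w' Ew].
    rewrite -gm -gm'.
    have /forallP/(_ w)/implyP/(_ vw)/eqP -> := H v.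
    have /forallP/(_ w)/implyP/(_ vw)/eqP -> := H' v.
    by rewrite Ew !glue_out.
  have aux m0 : (forall x, [forall v0, e x v0 ==> (glue3 t m0 b x == glue3 t m0 b v0)]) ->
      m0 i = (comp v \in phi m0).
    move=> H0; rewrite inE Cm /=; apply/idP/forall_inP=> [mi w|H1]; last first.
      by apply: (H1 v); rewrite compE; apply: connect0.
    rewrite compE => vw; have /forallP/(_ w)/implyP/(_ vw)/eqP := H0 v.
    move: Cm; rewrite inE => /andP[_ /forall_inP/(_ w)]; rewrite compE => /(_ vw)/eqP w1.
    by rewrite (glue3_mid t m0 b w1) => <-.
  by rewrite (aux m) // (aux m') // E.
apply: eq_card => S; rewrite [RHS]inE; apply/imsetP/idP => [[m _ ->]|SM].
  by apply/subsetP=> C; rewrite !inE => /andP[].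
pose m : {ffun 'I_r -> bool} := [ffun i => (comp (1, i) \in S) ||
   [exists w, e (1, i) (skip 1 w) && glue2 t b w]].
have mid1 v w : v.1 = 1 -> comp v \in S -> e v w -> w.1 = 1.
  move=> v1 vS vw; have := subsetP SM _ vS; rewrite inE => /andP[_ /forall_inP/(_ w)].
  by rewrite compE => /(_ vw)/eqP.
have pairE (v : vtx 3 r) : v.1 = 1 -> (1, v.2) = v by case: v => l i /= ->.
have gE v : glue3 t m b v = (comp v \in S) || [exists w, e v (skip 1 w) && glue2 t b w].
  have [v1|/outerP[w ->]] := eqVneq v.1 1.
    by rewrite glue3_mid // ffunE pairE.
  rewrite glue_out; have -> /= : (comp (skip 1 w) \in S) = false.
    apply: contraTF isT => /(subsetP SM); rewrite inE => /andP[_ /forall_inP/(_ (skip 1 w))].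
    rewrite compE => /(_ (connect0 _ _)) /eqP /= /esym /eqP.
    by rewrite (negbTE (neq_lift _ _)).
  apply/idP/existsP=> [tw|[w' /andP[ww tw]]]; first by exists w; rewrite tw andbT; exact: connect0.
  move: cg; rewrite cst_outer => /forallP/(_ w)/forallP/(_ w')/implyP/(_ ww)/eqP -> //.
exists m.
  rewrite inE cst_stack; apply/forallP=> u; apply/forallP=> v; apply/implyP=> uv.
  rewrite !gE (eq_comp _ _ uv); apply/eqP; congr (_ || _); apply: eq_existsb => w.
  by rewrite /e (same_connect (@stack_sym r p q) uv).
apply/setP=> C; rewrite inE; apply/idP/andP => [CS|[CM /forall_inP H]].
  have CM := subsetP SM _ CS; split=> //; apply/forall_inP=> v vC.
  move: (CM); rewrite inE => /andP[/imsetP[u _ Cu] /forall_inP H].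
  rewrite -(glue3_mid t m b (eqP (H v vC))) gE.
  have uv : e u v by rewrite -compE /comp -Cu.
  by rewrite -(eq_comp u v uv) /comp -Cu CS.
move: (CM); rewrite inE => /andP[/imsetP[u _ Cu] /forall_inP H1].
have uC : u \in C by rewrite Cu compE; exact: connect0.
have u1 := eqP (H1 u uC).
have := H u uC; rewrite -(glue3_mid t m b u1) gE; case/orP; first by rewrite /comp -Cu.
case/existsP=> w /andP[uw _]; have := H1 (skip 1 w); rewrite Cu -/(comp u) compE => /(_ uw)/eqP /esym/eqP.
by rewrite /= (negbTE (neq_lift _ _)).
Qed.

End Labellings.

Local Opaque compose mid_comps perm_diagram cst.

Section DiagramMonoid.
Variable r : nat.
Implicit Types (p q s : setpart r) (t m b : {ffun 'I_r -> bool}).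

Lemma cst_sub p q : (forall t b, cst p t b = cst q t b) ->
  sp_blocks p \subset sp_blocks q.
Proof.
move=> E.
have [/eqP cp tp p0] := and3P (sp_partition p).
have [/eqP cq tq q0] := and3P (sp_partition q).
have sep (p1 p2 : setpart r) u v : (forall t b, cst p1 t b = cst p2 t b) ->
  v \in pblock p1 u -> v \in pblock p2 u.
  move=> {}E uv.
  have [/eqP c1 t1 _] := and3P (sp_partition p1).
  have [/eqP c2 t2 _] := and3P (sp_partition p2).
  pose B := pblock p2 u; pose t : {ffun 'I_r -> bool} := [ffun i => (0, i) \in B].
  pose b : {ffun 'I_r -> bool} := [ffun i => (1, i) \in B].
  have gE w : glue2 t b w = (w \in B).
    by case: w => l i; case: (ord2P l) => ->; rewrite /glue2 /= ffunE.
  have uB : u \in B by rewrite mem_pblock c2 inE.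
  have Bp2 : B \in sp_blocks p2 by rewrite pblock_mem // c2 inE.
  have /cstP H : cst p1 t b.
    rewrite E; apply/cstP=> B' hB' x y hx hy; rewrite !gE.
    have BB' w : w \in B -> w \in B' -> B = B'.
      by move=> wB wB'; rewrite -(def_pblock t2 Bp2 wB) (def_pblock t2 hB' wB').
    by apply/idP/idP=> h; [rewrite (BB' x)|rewrite (BB' y)].
  have hu : u \in cover p1 by rewrite c1 inE.
  have := H _ (pblock_mem hu) u v; rewrite mem_pblock hu uv !gE uB => <- //.
apply/subsetP=> B hB.
have /set0Pn[u uB] : B != set0 by apply: contraNneq p0 => <-.
rewrite -(def_pblock tp hB uB).
have -> : pblock p u = pblock q u.
  by apply/setP=> v; apply/idP/idP; apply: sep => // t b; rewrite E.
by rewrite pblock_mem // cq inE.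
Qed.

Lemma cst_const p c : cst p [ffun=> c] [ffun=> c].
Proof. by apply/cstP=> B _ u v _ _; rewrite /glue2 !ffunE !if_same. Qed.

Lemma cst_inj p p' n n' :
  (forall t b, 2 ^ n * cst p t b = 2 ^ n' * cst p' t b)%N -> n = n' /\ p = p'.
Proof.
move=> E; have := E [ffun=> true] [ffun=> true].
rewrite !cst_const !muln1 => /eqP; rewrite eqn_exp2l // => /eqP nn'; split=> //.
subst n'; have {}E t b : cst p t b = cst p' t b.
  have /eqP := E t b; rewrite eqn_pmul2l ?expn_gt0 //.
  by case: (cst p t b); case: (cst p' t b).
by apply/val_inj/eqP; rewrite eqEsubset !cst_sub.
Qed.

Lemma compose_assoc p q s :
  (#|mid_comps p q| + #|mid_comps (compose p q) s|
     = #|mid_comps q s| + #|mid_comps p (compose q s)|)%N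
  /\ compose (compose p q) s = compose p (compose q s).
Proof.
apply: cst_inj => t b; rewrite [in LHS]expnD -mulnA -(sum_cst (compose p q) s t b).
rewrite [in RHS]expnD -mulnA -(sum_cst p (compose q s) t b) !big_distrr /=.
under eq_bigr => m _ do rewrite mulnA -(sum_cst p q t m) big_distrl /=.
rewrite exchange_big /=; apply: eq_bigr => m _; rewrite mulnCA -(sum_cst q s m b).
by rewrite big_distrr /=; apply: eq_bigr => m' _; rewrite mulnA.
Qed.

Lemma cst_id t b : cst (perm_diagram 1%g) t b = (t == b).
Proof.
apply/cstP/eqP => [H|-> _ /imsetP[i _ ->] u v].
  apply/ffunP=> i; have := H [set (0, i); (1, i)] _ (0, i) (1, i).
  rewrite !inE !eqxx orbT; apply=> //.
  by apply/imsetP; exists i => //; rewrite perm1.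
rewrite perm1 !inE /glue2.
by case: u v => l j [l' j'] /orP[] /eqP[-> ->] /orP[] /eqP[-> ->].
Qed.

Lemma compose_idl p :
  #|mid_comps (perm_diagram 1%g) p| = 0%N /\ compose (perm_diagram 1%g) p = p.
Proof.
apply: cst_inj => t b; rewrite -sum_cst mul1n (bigD1 t) //= cst_id eqxx mul1n.
rewrite big1 ?addn0 // => m /negbTE; rewrite cst_id eq_sym => ->; exact: mul0n.
Qed.

Lemma compose_idr p :
  #|mid_comps p (perm_diagram 1%g)| = 0%N /\ compose p (perm_diagram 1%g) = p.
Proof.
apply: cst_inj => t b; rewrite -sum_cst mul1n (bigD1 b) //= cst_id eqxx muln1.
rewrite big1 ?addn0 // => m /negbTE; rewrite cst_id => ->; exact: muln0.
Qed.

End DiagramMonoid.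

(* The free F-module on a finite type T, and the bilinear product determined  *)
(* by its values m p q on pairs of basis elements.                            *)
Section FreeModule.
Variables (F : fieldType) (T : finType).
Local Notation V := {ffun T -> F^o}.
Implicit Types (f g h : V) (m : T -> T -> V).

Definition basis (p : T) : V := [ffun q => (q == p)%:R].

Definition bilin m f g : V := \sum_p \sum_q (f p * g q) *: m p q.

Lemma basisE p q : basis p q = (q == p)%:R.
Proof. exact: ffunE. Qed.

Lemma basis_sum f : f = \sum_p f p *: basis p.
Proof.
apply/ffunP=> q; rewrite sum_ffunE (bigD1 q) //= big1 => [|p npq].
  by rewrite !ffunE eqxx addr0 [RHS]mulr1.
by rewrite !ffunE eq_sym (negbTE npq) [LHS]mulr0.
Qed.

Lemma bilinDl m : left_distributive (bilin m) +%R.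
Proof.
move=> f g h; rewrite /bilin -big_split; apply: eq_bigr => p _ /=.
by rewrite -big_split; apply: eq_bigr => q _ /=; rewrite ffunE -scalerDl mulrDl.
Qed.

Lemma bilinDr m : right_distributive (bilin m) +%R.
Proof.
move=> f g h; rewrite /bilin -big_split; apply: eq_bigr => p _ /=.
by rewrite -big_split; apply: eq_bigr => q _ /=; rewrite ffunE -scalerDl mulrDr.
Qed.

Lemma bilinZl m (a : F) f g : a *: bilin m f g = bilin m (a *: f) g.
Proof.
rewrite /bilin scaler_sumr; apply: eq_bigr => p _; rewrite scaler_sumr.
by apply: eq_bigr => q _; rewrite scalerA ffunE mulrA.
Qed.

Lemma bilinZr m (a : F) f g : a *: bilin m f g = bilin m f (a *: g).
Proof.
rewrite /bilin scaler_sumr; apply: eq_bigr => p _; rewrite scaler_sumr.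
by apply: eq_bigr => q _; rewrite scalerA ffunE mulrCA.
Qed.

Lemma bilin_suml m I (s : seq I) (G : I -> V) g :
  bilin m (\sum_(i <- s) G i) g = \sum_(i <- s) bilin m (G i) g.
Proof.
apply: (big_morph ((bilin m)^~ g)) => [u v|]; first exact: bilinDl.
by have := bilinZl m 0 0 g; rewrite !scale0r => <-.
Qed.

Lemma bilin_sumr m I (s : seq I) (G : I -> V) f :
  bilin m f (\sum_(i <- s) G i) = \sum_(i <- s) bilin m f (G i).
Proof.
apply: (big_morph (bilin m f)) => [u v|]; first exact: bilinDr.
by have := bilinZr m 0 f 0; rewrite !scale0r => <-.
Qed.

Lemma bilin_basis m p q : bilin m (basis p) (basis q) = m p q.
Proof.
rewrite /bilin (bigD1 p) //= [X in _ + X]big1 ?addr0 => [|p' np]; last first.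
  by apply: big1 => q' _; rewrite (basisE p) (negbTE np) mul0r scale0r.
rewrite (bigD1 q) //= [X in _ + X]big1 ?addr0 => [|q' nq]; last first.
  by rewrite (basisE q) (negbTE nq) mulr0 scale0r.
by rewrite !basisE !eqxx mul1r scale1r.
Qed.

Lemma bilin_expandl m f g : bilin m f g = \sum_p f p *: bilin m (basis p) g.
Proof.
rewrite {1}(basis_sum f) bilin_suml; apply: eq_bigr => p _.
by rewrite bilinZl.
Qed.

Lemma bilin_expandr m f g : bilin m f g = \sum_p g p *: bilin m f (basis p).
Proof.
rewrite {1}(basis_sum g) bilin_sumr; apply: eq_bigr => p _.
by rewrite bilinZr.
Qed.

Lemma bilinA m :
  (forall p q s, bilin m (basis p) (m q s) = bilin m (m p q) (basis s)) ->
  associative (bilin m).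
Proof.
move=> key f g h; rewrite (bilin_expandl m f (bilin m g h)) (bilin_expandl m f g).
rewrite bilin_suml; apply: eq_bigr => p _; rewrite -bilinZl; congr (_ *: _).
rewrite (bilin_expandl m g h) bilin_sumr (bilin_expandr m (basis p) g) bilin_suml.
apply: eq_bigr => q _; rewrite -bilinZr -bilinZl; congr (_ *: _).
rewrite (bilin_expandr m (basis q) h) (bilin_expandr m (bilin m _ _) h) bilin_sumr.
by apply: eq_bigr => s _; rewrite -bilinZr !bilin_basis key.
Qed.

Lemma bilin_id m e : (forall p, m e p = basis p) -> (forall p, m p e = basis p) ->
  left_id (basis e) (bilin m) * right_id (basis e) (bilin m).
Proof.
move=> el er; split=> f; rewrite [RHS]basis_sum.
  by rewrite bilin_expandr; apply: eq_bigr => p _; rewrite bilin_basis el.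
by rewrite bilin_expandl; apply: eq_bigr => p _; rewrite bilin_basis er.
Qed.

Lemma basis_neq0 p : basis p != 0.
Proof.
by apply/eqP=> /ffunP/(_ p); rewrite basisE ffunE eqxx => /eqP; rewrite oner_eq0.
Qed.

End FreeModule.

Definition palg (F : fieldType) (x : F) (r : nat) : Type := {ffun setpart r -> F^o}.

Section PartitionAlgebra.
Variables (F : fieldType) (x : F) (r : nat).
Local Notation P := (palg x r).

HB.instance Definition _ := GRing.Lmodule.copy P {ffun setpart r -> F^o}.

(* The diagram basis element L_p. *)
Definition diag (p : setpart r) : P := basis F p.

Definition diag_mul (p q : setpart r) : P :=
  x ^+ #|mid_comps p q| *: diag (compose p q).

Definition palg_mul : P -> P -> P := bilin diag_mul.

Lemma palg_mulA : associative palg_mul.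
Proof.
apply: bilinA => p q s; rewrite /diag_mul -bilinZl -bilinZr !bilin_basis /diag_mul.
have [E1 E2] := compose_assoc p q s.
by rewrite E2 !scalerA -!exprD E1.
Qed.

Lemma palg_mul_id : left_id (diag (perm_diagram 1%g)) palg_mul *
                    right_id (diag (perm_diagram 1%g)) palg_mul.
Proof.
apply: bilin_id => p; rewrite /diag_mul.
  by have [-> ->] := compose_idl p; rewrite scale1r.
by have [-> ->] := compose_idr p; rewrite scale1r.
Qed.

HB.instance Definition _ := GRing.Zmodule_isNzRing.Build P palg_mulA
  palg_mul_id.1 palg_mul_id.2 (@bilinDl _ _ _) (@bilinDr _ _ _)
  (basis_neq0 F (perm_diagram 1%g)).
HB.instance Definition _ := GRing.Lmodule_isLalgebra.Build F P (@bilinZl _ _ _).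
HB.instance Definition _ := GRing.Lalgebra_isAlgebra.Build F P (@bilinZr _ _ _).

End PartitionAlgebra.

Local Open Scope mset_scope.

Section Multisets.
Variable K : choiceType.

(* The multiset union of the members of M. *)
Definition msum (M : {mset {mset K}}) : {mset K} := \big[msetD/mset0]_(A <- M) A.

(* m(A)! *)
Definition mfact (A : {mset K}) : nat := \prod_(x <- undup A) (A x)`!.

Lemma msumE M x : msum M x = (\sum_(A <- M) (A : {mset K}) x)%N.
Proof.
rewrite /msum; apply: (big_morph (fun A : {mset K} => A x)) => [A B|].
  by rewrite msetE2.
exact: mset0E.
Qed.

Lemma msum_count M (P : pred K) :
  count P (msum M) = (\sum_(A <- M) count P (A : {mset K}))%N.
Proof.
apply: (big_morph (fun A : {mset K} => count P A)) => [A B|]; last by rewrite enum_mset0.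
rewrite -count_cat; move: P; apply/seq.permP/allP => x _ /=; apply/eqP.
by rewrite count_cat !count_mem_mset msetE2.
Qed.

(* An enumeration of the multisets of at most n elements of s, used only to   *)
(* equip multiset partitions with their finType structure.                    *)
Fixpoint msets_upto (s : seq K) (n : nat) : seq {mset K} :=
  if n is n'.+1 then
    let u := msets_upto s n' in mset0 :: [seq x +` A | x <- s, A <- u]
  else [:: mset0].

Lemma msets_uptoP s n (A : {mset K}) :
  {subset A <= s} -> (size A <= n)%N -> A \in msets_upto s n.
Proof.
elim: n A => [|n IH] A sA; first by rewrite leqn0 size_mset_eq0 inE.
case: (mset_0Vmem A) => [->|[x xA]]; first by rewrite mem_head.
have EA := msetB1K xA; rewrite -{1}EA => szA.
rewrite inE; apply/orP; right; rewrite -{1}EA; apply: allpairs_f; first exact: sA.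
apply: IH => [y yA|]; first by apply: sA; rewrite -EA in_mset1D yA orbT.
move: szA; suff -> : size (x +` (A `\ x)) = (size (A `\ x)).+1 by [].
rewrite -{1}(seq_mset_id (A `\ x)) -mset_cons.
exact: perm_size (perm_eq_seq_mset _).
Qed.

End Multisets.

Definition mmap (K L : choiceType) (f : K -> L) (A : {mset K}) : {mset L} :=
  seq_mset [seq f x | x <- A].

Section MultisetPartitions.
Variables (h r k : nat).

(* M is a multiset of nonempty multisets with, counting multiplicities, r     *)
(* elements from each of the h rows.                                          *)
Definition is_mpart (M : {mset {mset vtx h k}}) : bool :=
  (mset0 \notin M) &&
  [forall l, count (fun v => v.1 == l) (msum M) == r].

Record mpart := MPart { mp_blocks :> {mset {mset vtx h k}}; mpartP : is_mpart mp_blocks }.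

HB.instance Definition _ := [isSub for mp_blocks].
HB.instance Definition _ := [Choice of mpart by <:].

Definition mpart_seq : seq {mset {mset vtx h k}} :=
  msets_upto (msets_upto (enum {: vtx h k}) (h * r)) (h * r).

Lemma mpart_bounds (M : mpart) : (\sum_(A <- M) size (A : {mset _}) = h * r)%N.
Proof.
have /andP[_ /forallP H] := mpartP M.
transitivity (\sum_(l < h) count (fun v => v.1 == l) (msum M))%N.
  under [RHS]eq_bigr => l _ do rewrite msum_count.
  rewrite exchange_big /=; apply: eq_bigr => A _; rewrite -sum1_size.
  under [RHS]eq_bigr => l _ do rewrite -sum1_count big_mkcond.
  rewrite exchange_big; apply: eq_bigr => v _ /=.
  by rewrite -big_mkcond (big_pred1 v.1) // => l; rewrite eq_sym.
by under eq_bigr => l _ do rewrite (eqP (H l)); rewrite sum_nat_const card_ord.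
Qed.

Lemma mpart_mem (M : mpart) : mp_blocks M \in mpart_seq.
Proof.
have bM := mpart_bounds M.
apply: msets_uptoP => [A AM|].
  apply: msets_uptoP => [v _|]; first exact: mem_enum.
  by rewrite -bM (perm_big _ (perm_to_rem AM)) big_cons leq_addr.
rewrite -bM -sum1_size big_seq [X in (_ <= X)%N]big_seq; apply: leq_sum => A AM.
rewrite lt0n size_mset_eq0; apply: contraTneq AM => ->.
by have /andP[] := mpartP M.
Qed.

Definition mpart_sub (M : mpart) : seq_sub mpart_seq := SeqSub (mpart_mem M).
Definition sub_mpart (u : seq_sub mpart_seq) : option mpart := insub (ssval u).
Lemma mpart_subK : pcancel mpart_sub sub_mpart.
Proof. exact: valK. Qed.

HB.instance Definition _ := PCanIsCountable mpart_subK.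
HB.instance Definition _ : isFinite mpart := PCanIsFinite mpart_subK.

End MultisetPartitions.

(* Restriction to the elements outside row l, followed by the renumbering of  *)
(* the remaining rows (the inverse of skip l).  For h.+1 = 3, l = ord_max     *)
(* restricts to [k] u [k-bar]; l = 0 restricts to [k-bar] u [k-bar-bar] and   *)
(* removes one bar from every element; l = 1 restricts to [k] u [k-bar-bar]   *)
(* and removes one bar from the double-barred elements.                       *)
Section Restriction.
Variables (h r k : nat) (l : 'I_h.+1).

Definition unskip (v : vtx h.+1 k) : option (vtx h k) :=
  omap (fun l' => (l', v.2)) (unlift l v.1).

Definition brestr (A : {mset vtx h.+1 k}) : {mset vtx h k} := seq_mset (pmap unskip A).

Definition mrestr (M : {mset {mset vtx h.+1 k}}) : {mset {mset vtx h k}} :=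
  seq_mset [seq A <- [seq brestr A | A : {mset _} <- M] | A != mset0].

Lemma big_seq_mset (T : choiceType) (s : seq T) (f : T -> nat) :
  (\sum_(x <- seq_mset s) f x = \sum_(x <- s) f x)%N.
Proof. exact: perm_big (perm_eq_seq_mset s). Qed.

Lemma mrestr_is_mpart (M : mpart h.+1 r k) : is_mpart r (mrestr M).
Proof.
apply/andP; split.
  by rewrite (perm_mem (perm_eq_seq_mset _)) mem_filter eqxx.
apply/forallP=> l'; rewrite msum_count big_seq_mset big_filter big_mkcond big_map /=.
have /andP[_ /forallP/(_ (lift l l'))/eqP HM] := mpartP M.
rewrite -[X in _ == X]HM msum_count; apply/eqP; apply: eq_bigr => A _.
transitivity (count (fun v : vtx h k => v.1 == l') (brestr A)).
  by case: eqP => //= ->; rewrite enum_mset0.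
rewrite (seq.permP (perm_eq_seq_mset _)); elim: (A : seq _) => //= v s <-.
rewrite /unskip; case: unliftP => [j ->|->] /=.
  by rewrite (inj_eq (@lift_inj _ l)).
by rewrite (negbTE (neq_lift _ _)).
Qed.

Definition mp_restr (M : mpart h.+1 r k) : mpart h r k := MPart (mrestr_is_mpart M).

End Restriction.

(* N is obtained from M by combining blocks: G is a multiset of nonempty      *)
(* groups of blocks of M which together exhaust M, and N consists of the      *)
(* multiset unions of the groups.                                             *)
Definition mcoarser h r k (N M : mpart h r k) : bool :=
  `[< exists G : {mset {mset {mset vtx h k}}},
        [/\ mset0 \notin G, msum G = M & mp_blocks N = mmap (@msum _) G] >].

(* W_{r,k}: a part is at most r since the sum is r, so bounding the entries   *)
(* loses nothing and makes the type finite.                                   *)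
Record wcomp (r k : nat) := WComp {
  wc_parts :> k.-tuple 'I_r.+1;
  wcompP : sumn [seq val n | n <- wc_parts] == r }.

HB.instance Definition _ r k := [isSub for @wc_parts r k].
HB.instance Definition _ r k := [Finite of wcomp r k by <:].

Section Compositions.
Variables (r k : nat).

Lemma interval_subproof (a : wcomp r k) (i : 'I_r) :
  (reshape_index [seq val n | n <- a] i < k)%N.
Proof.
have := @reshape_indexP [seq val n | n <- a] i.
by rewrite (eqP (wcompP a)) ltn_ord size_map size_tuple; apply.
Qed.

(* The index of the consecutive interval of lengths a containing i. *)
Definition interval (a : wcomp r k) (i : 'I_r) : 'I_k := Ordinal (interval_subproof a i).

Definition young (a : wcomp r k) : {set 'S_r} :=
  [set s : 'S_r | [forall i, interval a (s i) == interval a i]].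

Section Mult.
Variables (h : nat) (l : 'I_h) (M : mpart h r k).

(* inord does not truncate here, by mult_le below. *)
Definition mult_tuple : k.-tuple 'I_r.+1 :=
  [tuple inord (msum M (l, j)) | j < k].

Lemma mult_sum : (\sum_(j < k) msum M (l, j) = r)%N.
Proof.
have /andP[_ /forallP/(_ l)/eqP HM] := mpartP M.
rewrite -[RHS]HM.
under eq_bigr => j _ do rewrite -count_mem_mset -sum1_count big_mkcond.
rewrite exchange_big -sum1_count [RHS]big_mkcond; apply: eq_bigr => -[l' j] _ /=.
rewrite -big_mkcond (eq_bigl (fun i => (i == j) && (l' == l))); last first.
  by move=> i /=; rewrite xpair_eqE andbC eq_sym.
by case: (l' == l); [rewrite (eq_bigl (pred1 j)) ?big_pred1_eq // => i /=; rewrite andbT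
                    | rewrite big1 // => i; rewrite andbF].
Qed.

Lemma mult_le j : (msum M (l, j) < r.+1)%N.
Proof. by rewrite ltnS -[X in (_ <= X)%N]mult_sum (bigD1 j) //= leq_addr. Qed.

Lemma mult_subproof : sumn [seq val n | n <- mult_tuple] == r.
Proof.
rewrite sumnE big_map big_tuple -[X in _ == X]mult_sum; apply/eqP.
by apply: eq_bigr => j _; rewrite tnth_mktuple /= inordK ?mult_le.
Qed.

Definition mult : wcomp r k := WComp mult_subproof.

End Mult.

Section Kappa.
Variables (a b : wcomp r k).

Definition recolor (v : vtx 2 r) : vtx 2 k :=
  (v.1, interval (if v.1 == 0 then a else b) v.2).

Definition kappa_blocks (p : setpart r) : {mset {mset vtx 2 k}} :=
  seq_mset [seq seq_mset [seq recolor v | v <- enum B] | B : {set _} <- enum (sp_blocks p)].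

Lemma kappa_subproof p : is_mpart r (kappa_blocks p).
Proof.
have [/eqP cp tp p0] := and3P (sp_partition p).
apply/andP; split.
  rewrite (perm_mem (perm_eq_seq_mset _)); apply: contra p0 => /mapP[B].
  rewrite mem_enum => hB /esym/eqP.
  rewrite -size_mset_eq0 (perm_size (perm_eq_seq_mset _)) size_map -cardE cards_eq0.
  by move=> /eqP <-.
apply/forallP=> l; rewrite msum_count big_seq_mset big_map big_enum /=.
transitivity (\sum_(B in sp_blocks p) \sum_(v in B) (v.1 == l) == r)%N.
  congr (_ == _); apply: eq_bigr => B _; rewrite (seq.permP (perm_eq_seq_mset _)).
  by rewrite count_map -sum1_count -big_enum /= big_mkcond; apply: eq_bigr => v _; case: eqP.
rewrite -(big_trivIset _ tp) cp /=.
rewrite (eq_bigl xpredT) => [|v]; last by rewrite inE.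
rewrite -(pair_bigA _ (fun l' (i : 'I_r) => nat_of_bool (l' == l))) /= (bigD1 l) //=.
rewrite eqxx sum1_card card_ord big1 ?addn0 ?eqxx // => l' /negbTE ->.
by rewrite big1.
Qed.

Definition kappa (p : setpart r) : mpart 2 r k := MPart (kappa_subproof p).

End Kappa.
End Compositions.

Section KappaSurjective.

Lemma align (S T : eqType) (s : seq (S * T)) (n : nat) (w : 'I_n -> T) :
  perm_eq [seq u.2 | u <- s] [seq w i | i : 'I_n] ->
  exists g : 'I_n -> S, perm_eq s [seq (g i, w i) | i : 'I_n].
Proof.
move=> E; have sz : size s == n.
  by rewrite -(size_map snd) (perm_size E) size_map size_enum_ord.
have [s' [ss' Es']] : exists s', perm_eq s s' /\ [seq u.2 | u <- s'] = [seq w i | i : 'I_n].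
  case: s E {sz} => [|x s] E.
    by exists [::]; split=> //; move: E; rewrite perm_sym => /perm_nilP ->.
  rewrite perm_sym in E; have [Is IsE wE] := perm_iotaP x.2 E.
  exists [seq nth x (x :: s) i | i <- Is]; split.
    rewrite perm_sym -[X in perm_eq _ X](mkseq_nth x) /mkseq.
    by apply: perm_map; rewrite (perm_trans IsE) // size_map.
  rewrite wE -map_comp; apply/eq_in_map => i; rewrite (perm_mem IsE) mem_iota add0n size_map.
  by move=> /andP[_ hi]; rewrite (nth_map x).
have sz' : size s' == n by rewrite -(perm_size ss').
pose t := Tuple sz'; exists (fun i => (tnth t i).1).
apply: perm_trans ss' _; rewrite -[s']/(tval t).
suff -> : [seq ((tnth t i).1, w i) | i : 'I_n] = tval t by [].
rewrite -[RHS]map_tnth_enum; apply: eq_map => i.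
suff -> : w i = (tnth t i).2 by case: (tnth t i).
have -> : (tnth t i).2 = nth (w i) [seq u.2 | u <- s'] i.
  have hi : (i < size s')%N by rewrite (eqP sz').
  have x0 := tnth t i; rewrite (nth_map x0) //; congr (_.2); exact: tnth_nth.
by rewrite Es' (nth_map i) ?size_enum_ord // nth_ord_enum.
Qed.

Variables (r k : nat).

Lemma count_interval (a : wcomp r k) (c : 'I_k) :
  count_mem c [seq interval a i | i : 'I_r] = tnth a c.
Proof.
set sh := [seq val n | n <- a].
have szsh : size sh = k by rewrite size_map size_tuple.
pose ss := [seq nseq (nth 0%N sh j) j | j <- iota 0 k].
have shE : shape ss = sh.
  rewrite /shape -map_comp -[RHS](mkseq_nth 0%N) szsh; apply: eq_map => j /=.
  by rewrite size_nseq.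
have wE : [seq val (interval a i) | i : 'I_r] = flatten ss.
  apply: (@eq_from_nth _ 0%N) => [|i].
    by rewrite size_map size_enum_ord size_flatten shE (eqP (wcompP a)).
  rewrite size_map size_enum_ord => hi.
  rewrite (nth_map (Ordinal hi)) ?size_enum_ord // nth_flatten shE /=.
  rewrite (nth_ord_enum _ (Ordinal hi)) /= -/sh.
  have hr : (reshape_index sh i < size sh)%N.
    by apply: reshape_indexP; rewrite (eqP (wcompP a)).
  have ho : (reshape_offset sh i < nth 0%N sh (reshape_index sh i))%N.
    by apply: reshape_offsetP; rewrite (eqP (wcompP a)).
  rewrite szsh in hr.
  by rewrite (nth_map 0%N) ?size_iota // nth_iota // add0n nth_nseq ho.
transitivity (count_mem (val c) (flatten ss)).
  by rewrite -wE !count_map; apply: eq_count => j.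
rewrite count_flatten -map_comp sumnE big_map (bigD1_seq (val c)) ?iota_uniq ?mem_iota //=.
rewrite count_nseq /= eqxx mul1n big1 ?addn0 => [|j]; last first.
  by rewrite count_nseq /= => /negbTE ->.
by rewrite (nth_map (tnth a c)) ?size_tuple // -tnth_nth.
Qed.

Lemma kappa_surj (M : mpart 2 r k) : exists p, kappa (mult 0 M) (mult 1 M) p == M.
Proof.
pose bl : seq {mset vtx 2 k} := mp_blocks M; pose n := size bl.
pose B (j : 'I_n) : {mset vtx 2 k} := nth mset0 bl j.
have blE : [seq B j | j : 'I_n] = bl.
  by rewrite -[RHS](mkseq_nth mset0) /mkseq -val_enum_ord -map_comp.
pose s (l : 'I_2) := flatten [seq [seq (j, v.2) | v <- B j & v.1 == l] | j : 'I_n].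
have sE l j c : count_mem (j, c) (s l) = B j (l, c).
  rewrite count_flatten -map_comp sumnE big_map big_enum /= (bigD1 j) //=.
  rewrite big1 ?addn0 => [|j' nj]; last first.
    by rewrite count_map; apply/eqP; rewrite -leqn0 leqNgt -has_count; apply/hasPn=> v _ /=;
      rewrite xpair_eqE (negbTE nj).
  rewrite count_map count_filter -count_mem_mset; apply: eq_count => -[l' c'] /=.
  by rewrite !xpair_eqE eqxx andTb andbC.
have H (l : 'I_2) : exists g : 'I_r -> 'I_n, perm_eq (s l) [seq (g i, interval (mult l M) i) | i : 'I_r].
  apply: align; apply/allP=> c _ /=; rewrite count_interval tnth_mktuple inordK ?mult_le //.
  rewrite msumE -[enum_mset M]/bl -blE big_map big_enum /=.
  under eq_bigr => j _ do rewrite -sE.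
  rewrite count_map -sum1_count big_mkcond /=.
  under [X in _ == X]eq_bigr => j _ do rewrite -sum1_count big_mkcond /=.
  rewrite exchange_big /=; apply/eqP; apply: eq_bigr => -[j' c'] _ /=.
  rewrite (bigD1 j') //= big1 ?addn0 ?xpair_eqE ?eqxx // => j /negbTE.
  by rewrite xpair_eqE eq_sym => ->.
have [g0 E0] := H 0; have [g1 E1] := H 1.
pose lab (v : vtx 2 r) := if v.1 == 0 then g0 v.2 else g1 v.2.
pose L j := [set v | lab v == j].
have cL j l c : count_mem (l, c) [seq recolor (mult 0 M) (mult 1 M) v | v <- enum (L j)] = B j (l, c).
  have Hl (l' : 'I_2) (g : 'I_r -> 'I_n) (a : wcomp r k) :
     (forall i, lab (l', i) = g i) -> (forall i, recolor (mult 0 M) (mult 1 M) (l', i) = (l', interval a i)) ->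
     perm_eq (s l') [seq (g i, interval a i) | i : 'I_r] ->
     count_mem (l', c) [seq recolor (mult 0 M) (mult 1 M) v | v <- enum (L j)] = B j (l', c).
    move=> labE recE Eg; rewrite -sE (seq.permP Eg) count_map [in RHS]count_map.
    rewrite -!sum1_count !big_enum_cond /= big_mkcond.
    pose F (l1 : 'I_2) (i : 'I_r) := if ((l1, i) \in L j) &&
      (recolor (mult 0 M) (mult 1 M) (l1, i) == (l', c)) then 1%N else 0%N.
    rewrite (eq_bigr (fun v => F v.1 v.2)) => [|[]] //.
    rewrite -(pair_bigA _ F) /= /F.
    rewrite (bigD1 l') //= addnC big1 ?add0n => [|l1 /negbTE nl]; last first.
      by apply: big1 => i _; rewrite xpair_eqE nl andbF.
    rewrite [RHS]big_mkcond; apply: eq_bigr => i _.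
    by rewrite inE labE recE !xpair_eqE eqxx.
  by case: (ord2P l) => ->; [apply: (Hl 0 g0 (mult 0 M)) | apply: (Hl 1 g1 (mult 1 M))].
have LE j : seq_mset [seq recolor (mult 0 M) (mult 1 M) v | v <- enum (L j)] = B j.
  by apply/msetP=> -[l c]; rewrite mset_seqE cL.
have L0 j : L j != set0.
  have : B j != mset0.
    have /andP[M0 _] := mpartP M; apply: contraNneq M0 => <-.
    by apply: (@mem_nth _ mset0 bl); apply: ltn_ord.
  by apply: contraNneq => E; rewrite -LE E enum_set0; apply/eqP/msetP=> v; rewrite mset_seqE mset0E.
have L_inj : injective L.
  move=> j j' E; have /set0Pn[v] := L0 j; rewrite inE => /eqP vj.
  by move/setP/(_ v): E; rewrite !inE vj eqxx => /esym/eqP.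
have Lp : partition [set L j | j : 'I_n] [set: vtx 2 r].
  apply/and3P; split.
  - apply/eqP/setP=> v; rewrite in_setT; apply/bigcupP; exists (L (lab v)).
      exact: imset_f.
    by rewrite inE.
  - apply/trivIsetP=> _ _ /imsetP[j _ ->] /imsetP[j' _ ->] njj'.
    rewrite disjoints_subset; apply/subsetP=> v; rewrite !inE => /eqP ->.
    by apply: contraNneq njj' => ->.
  - by apply/imsetP=> -[j _] /esym/eqP; rewrite (negbTE (L0 j)).
exists (SetPart Lp); apply/eqP/val_inj => /=; rewrite /kappa_blocks /=.
rewrite -[RHS]seq_mset_id -[enum_mset _]/bl -blE; apply/eq_seq_msetP.
have /(perm_map (fun A : {set vtx 2 r} => seq_mset [seq recolor (mult 0 M) (mult 1 M) v | v <- enum A])) :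
    perm_eq (enum [set L j | j : 'I_n]) [seq L j | j : 'I_n].
  apply: uniq_perm; rewrite ?enum_uniq ?(map_inj_uniq L_inj) ?enum_uniq // => A.
  rewrite mem_enum; apply/imsetP/mapP=> -[j]; first by exists j; rewrite ?mem_enum.
  by exists j.
rewrite -map_comp (eq_map LE); exact: id.
Qed.

End KappaSurjective.

Lemma coarser_refl r (p : setpart r) : coarser p p.
Proof.
have [/eqP cp tp p0] := and3P (sp_partition p).
have cov1 (B : {set vtx 2 r}) : cover [set B] = B by rewrite cover1.
apply/existsP; exists [set [set B] | B in sp_blocks p]; apply/andP; split.
  apply/and3P; split.
  - apply/eqP/setP=> B; apply/bigcupP/idP => [[_ /imsetP[C hC ->]]|hB].
      by rewrite inE => /eqP->.
    by exists [set B]; rewrite ?inE // imset_f.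
  - apply/trivIsetP=> _ _ /imsetP[B hB ->] /imsetP[C hC ->] nBC.
    by rewrite disjoints1 inE; apply: contraNneq nBC => ->.
  - by apply/imsetP=> -[B _ /setP/(_ B)]; rewrite !inE eqxx.
rewrite -imset_comp; apply/eqP/setP=> B; apply/idP/imsetP => [hB|[C hC ->]].
  by exists B; rewrite //= cov1.
by rewrite /= cov1.
Qed.

Lemma coarser_card r (q p : setpart r) :
  coarser q p -> q != p -> (#|sp_blocks q| < #|sp_blocks p|)%N.
Proof.
case/existsP=> G /andP[/and3P[/eqP cG tG G0] /eqP qE] npq.
have leG : (#|G| <= #|sp_blocks p| ?= iff [forall A in G, #|A| == 1%N])%N.
  rewrite -cG -(eqP tG) -sum1_card; apply: leqif_sum => A hA.
  split; last by rewrite eq_sym.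
  by rewrite card_gt0; apply: contraNneq G0 => <-.
have le1 : (#|sp_blocks q| <= #|G|)%N by rewrite qE leq_imset_card.
apply: leq_ltn_trans le1 _; rewrite ltn_neqAle !leG andbT.
apply: contra npq => /forall_inP G1; apply/eqP/val_inj => /=; rewrite qE.
apply/setP=> B; apply/imsetP/idP => [[A hA ->]|].
  have /cards1P[C eA] := G1 A hA; rewrite eA cover1 -cG; apply/bigcupP.
  by exists A; rewrite // eA set11.
rewrite -cG => /bigcupP[A hA BA]; exists A => //.
by have /cards1P[C eA] := G1 A hA; move: BA; rewrite eA inE cover1 => /eqP.
Qed.

(* The orbit basis: diag_orbit is the unitriangular system that determines    *)
(* it; it is solved by recursion on the number of blocks.                     *)
Section OrbitBasis.
Variables (F : fieldType) (x : F) (r : nat).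
Implicit Types p q : setpart r.

Fixpoint orbit_rec (n : nat) p : palg x r :=
  if n is n'.+1 then
    diag x p - \sum_(q | coarser q p && (q != p)) orbit_rec n' q
  else 0.

Definition orbit p : palg x r := orbit_rec #|sp_blocks p|.+1 p.

Lemma orbit_rec_fuel n m p : (#|sp_blocks p| < n)%N -> (#|sp_blocks p| < m)%N ->
  orbit_rec n p = orbit_rec m p.
Proof.
elim: n m p => [|n IH] [|m] p //; rewrite !ltnS => pn pm /=.
congr (_ - _); apply: eq_bigr => q /andP[qp nqp]; have lt_qp := coarser_card qp nqp.
by apply: IH; apply: leq_trans lt_qp _.
Qed.

Lemma diag_orbit p : diag x p = \sum_(q | coarser q p) orbit q.
Proof.
rewrite (bigD1 p) ?coarser_refl //=.
rewrite [X in X + _]/orbit /= [X in _ = _ - X + _](eq_bigr (@orbit)) ?subrK //.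
move=> q /andP[qp nqp]; by apply: orbit_rec_fuel; rewrite ?(coarser_card qp nqp).
Qed.

End OrbitBasis.

Section TildeAlgebra.
Variables (F : fieldType) (x : F) (r k : nat).
Local Notation P := (palg x r).
Local Notation W := (wcomp r k).

(* The symmetrizer s_a. *)
Definition symz (a : W) : P :=
  (#|young a|%:R)^-1 *: \sum_(s in young a) diag x (perm_diagram s).

(* The external direct sum of the spaces s_a P_r(x) s_b over the pairs (a, b). *)
Definition corners : {pred {ffun W * W -> P}} := fun u =>
  `[< forall a b, exists f : P, u (a, b) = symz a * f * symz b >].

Record ptilde := PTilde {
  pt_fun :> {ffun W * W -> P};
  ptildeP : pt_fun \in corners }.

HB.instance Definition _ := [isSub for pt_fun].
HB.instance Definition _ := [Choice of ptilde by <:].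

Lemma corners_submod : GRing.submod_closed corners.
Proof.
split=> [|c u v]; rewrite ![_ \in corners]unfold_in.
  by apply/asboolP => a b; exists 0; rewrite ffunE mulr0 mul0r.
move=> /asboolP Hu /asboolP Hv; apply/asboolP => a b.
have [f Ef] := Hu a b; have [g Eg] := Hv a b; exists (c *: f + g).
by rewrite !ffunE Ef Eg mulrDr mulrDl -(scalerAr c _ f) -(scalerAl c).
Qed.

HB.instance Definition _ := GRing.isSubmodClosed.Build _ _ corners
  (GRing.submod_closed_semi corners_submod).
HB.instance Definition _ := [SubChoice_isSubLmodule of ptilde by <:].

(* (s_a f s_b) . (s_c g s_d) = delta_{b,c} (s_a f s_b) (s_b g s_d), and       *)
(* s_b s_b = s_b: the product is a matrix product over P_r(x).                *)
Lemma ptilde_mul_subproof (u v : ptilde) :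
  [ffun ab : W * W => \sum_c u (ab.1, c) * v (c, ab.2)] \in corners.
Proof.
rewrite unfold_in; apply/asboolP => a b.
have /asboolP Hu := ptildeP u; have /asboolP Hv := ptildeP v.
have H c : exists f, u (a, c) * v (c, b) = symz a * f * symz b.
  have [f ->] := Hu a c; have [g ->] := Hv c b.
  by exists (f * symz c * symz c * g); rewrite !mulrA.
have [f Ef] := choice H; exists (\sum_c f c).
by rewrite ffunE mulr_sumr mulr_suml; apply: eq_bigr.
Qed.

Definition ptilde_mul (u v : ptilde) : ptilde := PTilde (ptilde_mul_subproof u v).

(* s_a f s_b, seen in the summand of index (a, b). *)
Lemma summand_subproof (a b : W) (f : P) :
  [ffun ab : W * W => if ab == (a, b) then symz a * f * symz b else 0] \in corners.
Proof.
rewrite unfold_in; apply/asboolP => a' b'; rewrite ffunE.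
case: eqP => [[-> ->]|_]; first by exists f.
by exists 0; rewrite mulr0 mul0r.
Qed.

Definition summand (a b : W) (f : P) : ptilde := PTilde (summand_subproof a b f).

(* A set partition whose image under kappa is M.  The elements s_a L_p s_b    *)
(* and s_a T_p s_b depend only on kappa a b p, so the choice is immaterial.   *)
Definition rep (M : mpart 2 r k) : setpart r := xchoose (kappa_surj M).

(* The diagram-like basis element D_M and the orbit-like basis element O_M. *)
Definition dbasis (M : mpart 2 r k) : ptilde :=
  summand (mult 0 M) (mult 1 M) (diag x (rep M)).

Definition obasis (M : mpart 2 r k) : ptilde :=
  summand (mult 0 M) (mult 1 M) (orbit x (rep M)).

End TildeAlgebra.

Definition mpalg (F : fieldType) (x : F) (r k : nat) : Type :=
  {ffun mpart 2 r k -> F^o}.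

Section MultisetPartitionAlgebra.
Variables (F : fieldType) (x : F) (r k : nat).
Local Notation MP := (mpalg x r k).

HB.instance Definition _ := GRing.Lmodule.copy MP {ffun mpart 2 r k -> F^o}.

Definition xbasis (M : mpart 2 r k) : MP := basis F M.

(* The falling factorial (t)_n. *)
Definition ffall (t : F) (n : nat) : F := \prod_(i < n) (t - i%:R).

Definition gammas (M N : mpart 2 r k) : {set mpart 3 r k} :=
  [set g | (mp_restr ord_max g == M) && (mp_restr ord0 g == N)].

(* beta_g *)
Definition mid_blocks (g : mpart 3 r k) : {mset {mset vtx 3 k}} :=
  seq_mset [seq A : {mset _} <- g | all (fun v => v.1 == 1) A].

Definition blocks_over (g : mpart 3 r k) (S : {mset vtx 2 k}) : {mset {mset vtx 3 k}} :=
  seq_mset [seq A <- g | brestr 1 A == S].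

Definition coef_a (g : mpart 3 r k) : F :=
  \prod_(S <- undup (mp_restr 1 g))
    ((size (blocks_over g S))`!%:R / (mfact (blocks_over g S))%:R).

Definition coef_b (g : mpart 3 r k) : F :=
  ffall (x - (size (mp_restr 1 g))%:R) (size (mid_blocks g)) / (mfact (mid_blocks g))%:R.

Definition mpalg_mul : MP -> MP -> MP :=
  bilin (fun M N => \sum_(g in gammas M N) (coef_a g * coef_b g) *: xbasis (mp_restr 1 g)).

(* brestr 0 keeps exactly the barred elements of a block. *)
Definition omega (M : mpart 2 r k) : F :=
  (mfact M)%:R / #|young (mult 0 M)|%:R * \prod_(A <- M) (mfact (brestr 0 A))%:R.

(* A multiplicative bijection also preserves the identity element. *)
Definition alg_iso (phi : {linear ptilde x r k -> MP}) : Prop :=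
  bijective phi /\ {morph phi : u v / ptilde_mul u v >-> mpalg_mul u v}.

End MultisetPartitionAlgebra.

(* C(x), where R[i] is the field of complex numbers over the reals R. *)
Definition ratfun (R : realType) : fieldType := {fraction {poly R[i]}}.
Definition indet (R : realType) : ratfun R := FracField.tofrac 'X.

Definition coef_c r k (a b : wcomp r k) (N : mpart 2 r k) (p : setpart r) : nat :=
  #|[set q : setpart r | coarser q p && (kappa a b q == N)]|.

(* Main.v *)
Require Import Defs.
From mathcomp Require Import all_boot all_order all_algebra.
From mathcomp Require Import finmap multiset complex.
From mathcomp Require Import boolp reals.
From mathcomp Require Import fingroup perm.
Import GRing.Theory.
Local Open Scope ring_scope.

Set Implicit Arguments.
Unset Strict Implicit.
Unset Printing Implicit Defensive.

(* Two set partitions with the same image under kappa differ by permutations  *)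
(* s and u of the two rows lying in the Young subgroups.  Since               *)
(* L_{(s,u)p} = L_s L_p L_{u^-1}, and likewise for T because coarsening is    *)
(* equivariant, these permutations are absorbed by the symmetrizers, so       *)
(* s_a L_p s_b and s_a T_p s_b depend only on kappa(p).  Multiplying          *)
(* L_p = sum_{q <= p} T_q by s_a and s_b and grouping the terms by kappa(q)   *)
(* expands D in the basis O; then phi is applied.                             *)

(** The relation L_p = sum of T_q over q <= p survives multiplication by the symmetrizers, after
    which each term depends only on its image under [kappa]. Indeed, [kappa_eq_permute] puts
    diagrams with the same image in one orbit of the Young subgroups, [diag_permute] and
    [orbit_permute] turn this action into multiplication by permutation diagrams, and [symz_perm]
    and [perm_symz] absorb those. [mcoarser_kappa] bounds the range of summation, and in
    [dbasis_obasis_coef] equal terms are collected, so that O_N occurs once for each q counted by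
    [coef_c]. The theorem is the image of that identity under [phi]. *)

Section PermutedDiagrams.
Variable r : nat.
Implicit Types (p q : setpart r) (g : {perm vtx 2 r}) (s u : 'S_r).

Lemma permute_partition g p :
  partition [set g @: (B : {set vtx 2 r}) | B in sp_blocks p] [set: vtx 2 r].
Proof.
have -> : [set: vtx 2 r] = g @: [set: vtx 2 r].
  by apply/setP=> v; rewrite inE; apply/esym/imsetP; exists (g^-1%g v); rewrite ?inE ?permKV.
by rewrite imset_partition ?sp_partition //; exact: perm_inj.
Qed.

Definition permute g p : setpart r := SetPart (permute_partition g p).

Lemma permuteM g g' p : permute g' (permute g p) = permute (g * g')%g p.
Proof.
apply: val_inj; rewrite /= -imset_comp; apply: eq_imset => B /=.
by rewrite -imset_comp; apply: eq_imset => v; rewrite /= permM.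
Qed.

Lemma permute1 p : permute 1%g p = p.
Proof.
apply: val_inj; rewrite /= -[RHS]imset_id; apply: eq_imset => B.
by rewrite -[RHS]imset_id; apply: eq_imset => v; rewrite perm1.
Qed.

Lemma permuteK g : cancel (permute g) (permute g^-1%g).
Proof. by move=> p; rewrite permuteM mulgV permute1. Qed.

Lemma permuteKV g : cancel (permute g^-1%g) (permute g).
Proof. by move=> p; rewrite permuteM mulVg permute1. Qed.

(** A grouping of the blocks is carried along by the permutation; the converse is the same fact for
    the inverse. *)
Lemma coarser_permute g q p : coarser (permute g q) (permute g p) = coarser q p.
Proof.
suff H g' q' p' : coarser q' p' -> coarser (permute g' q') (permute g' p').
  by apply/idP/idP=> [/(H g^-1%g)|]; rewrite ?permuteK //; exact: H.
case/existsP=> G /andP[Gp /eqP qE]; apply/existsP.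
pose f (B : {set vtx 2 r}) := g' @: B.
have finj : injective f by apply/imset_inj/perm_inj.
exists [set f @: (A : {set {set vtx 2 r}}) | A in G]; apply/andP; split.
  by rewrite /= imset_partition.
rewrite /= qE -!imset_comp; apply/eqP/eq_imset => A /=.
by rewrite imset_cover /cover big_imset //; move=> ? ? _ _; exact: finj.
Qed.

Lemma row_perm_inj s u :
  injective (fun v : vtx 2 r => (v.1, if v.1 == 0 then s v.2 else u v.2)).
Proof. by move=> [l i] [l' i'] [<-]; case: ifP => _ /perm_inj ->. Qed.

Definition row_perm s u : {perm vtx 2 r} := perm (@row_perm_inj s u).

Lemma row_permM s u s' u' : (row_perm s u * row_perm s' u')%g = row_perm (s * s') (u * u').
Proof.
by apply/permP=> -[l i]; rewrite permM !permE /=; case: (l == 0).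
Qed.

(** By [cst_inj] a diagram is determined by its matrix [cst], so identities of diagrams are checked
    on matrices. Here the row permutations become a reindexing of rows and columns. *)
Lemma cst_permute s u p t b :
  cst (permute (row_perm s u) p) t b = cst p [ffun i => t (s i)] [ffun i => b (u i)].
Proof.
have E v : glue2 t b (row_perm s u v) = glue2 [ffun i => t (s i)] [ffun i => b (u i)] v.
  by case: v => l i; rewrite permE /glue2 /=; case: (l == 0); rewrite ffunE.
apply/cstP/cstP=> [H B hB v w hv hw|H _ /imsetP[B hB ->] _ _ /imsetP[v hv ->] /imsetP[w hw ->]].
  by rewrite -!E; apply: (H (row_perm s u @: B)); rewrite imset_f.
by rewrite !E; apply: (H B hB).
Qed.

Lemma cst_perm_diagram s t b : cst (perm_diagram s) t b = (b == [ffun i => t (s i)]).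
Proof.
apply/cstP/eqP => [H|-> _ /imsetP[i _ ->] u v].
  apply/ffunP=> i; rewrite ffunE.
  apply: (H [set (0, s i); (1, i)] _ (1, i) (0, s i)); rewrite ?inE ?eqxx ?orbT //.
  by apply/imsetP; exists i.
rewrite !inE /glue2.
by case: u v => l j [l' j'] /orP[] /eqP[-> ->] /orP[] /eqP[-> ->]; rewrite /= ?ffunE.
Qed.

(** The matrix of [perm_diagram s] has a single 1 in each row, so one term of the matrix product in
    [sum_cst] survives; [cst_inj] then gives both claims at once. *)
Lemma compose_perm_l s p : #|mid_comps (perm_diagram s) p| = 0%N /\
  compose (perm_diagram s) p = permute (row_perm s 1) p.
Proof.
apply: cst_inj => t b; rewrite -sum_cst mul1n cst_permute.
rewrite (bigD1 [ffun i => t (s i)]) //= cst_perm_diagram eqxx mul1n big1 ?addn0.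
  by congr (nat_of_bool (cst _ _ _)); apply/ffunP=> i; rewrite ffunE perm1.
by move=> m /negbTE; rewrite cst_perm_diagram => ->.
Qed.

(** The inverse appears because the diagram of u^-1, below p, forces the middle labelling to be b
    composed with u. *)
Lemma compose_perm_r u p : #|mid_comps p (perm_diagram u^-1)| = 0%N /\
  compose p (perm_diagram u^-1) = permute (row_perm 1 u) p.
Proof.
have E (m b : {ffun 'I_r -> bool}) :
    cst (perm_diagram u^-1) m b = (m == [ffun i => b (u i)]).
  rewrite cst_perm_diagram; apply/eqP/eqP => ->; apply/ffunP=> i; rewrite !ffunE.
    by rewrite permK.
  by rewrite permKV.
apply: cst_inj => t b; rewrite -sum_cst mul1n cst_permute.
rewrite (bigD1 [ffun i => b (u i)]) //= E eqxx muln1 big1 ?addn0.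
  suff -> : [ffun i => t ((1 : 'S_r)%g i)] = t by [].
  by apply/ffunP=> i; rewrite ffunE perm1.
by move=> m /negbTE; rewrite E => ->; rewrite muln0.
Qed.

Variables (F : fieldType) (x : F).

Lemma diag_mulE p q :
  diag x p * diag x q = x ^+ #|mid_comps p q| *: diag x (compose p q).
Proof. exact: bilin_basis. Qed.

Lemma diag_permute s u p : diag x (permute (row_perm s u) p) =
  diag x (perm_diagram s) * diag x p * diag x (perm_diagram u^-1).
Proof.
have [E1 E2] := compose_perm_l s p.
rewrite diag_mulE E1 E2 scale1r.
have [E3 E4] := compose_perm_r u (permute (row_perm s 1) p).
by rewrite diag_mulE E3 E4 scale1r permuteM row_permM mulg1 mul1g.
Qed.

(** [permute g] maps the coarsenings of p bijectively to those of its image, so both sides satisfy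
    the same recursion. *)
Lemma orbit_permute s u p : Defs.orbit x (permute (row_perm s u) p) =
  diag x (perm_diagram s) * Defs.orbit x p * diag x (perm_diagram u^-1).
Proof.
set g := row_perm s u.
have g_inj : injective (permute g) := can_inj (@permuteK g).
have cardE : #|sp_blocks (permute g p)| = #|sp_blocks p|.
  by rewrite /= card_imset //; apply/imset_inj/perm_inj.
(* The recursion depth is the same on both sides since the number of blocks is preserved; the
   identity is proved at every depth. *)
rewrite /Defs.orbit cardE; move: #|_|.+1 => n; elim: n p {cardE} => [|n IH] p /=.
  by rewrite mulr0 mul0r.
rewrite mulrBr mulrBl -diag_permute mulr_sumr mulr_suml; congr (_ - _).
rewrite (reindex (permute g)) /=; last first.
  by exists (permute g^-1%g) => q _; rewrite ?permuteK ?permuteKV.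
by apply: eq_big => q; rewrite ?coarser_permute ?(inj_eq g_inj) // => _; exact: IH.
Qed.

(** The order is reversed because [u * s] applies u first. *)
Lemma perm_diagramM s u : diag x (perm_diagram s) * diag x (perm_diagram u) =
  diag x (perm_diagram (u * s)).
Proof.
have [E1 E2] := compose_perm_l s (perm_diagram u).
rewrite diag_mulE E1 E2 scale1r; congr (diag x _).
apply: (@cst_inj _ _ _ 0 0 _).2 => t b.
rewrite cst_permute !cst_perm_diagram; congr (_ * nat_of_bool (_ == _))%N.
  by apply/ffunP=> i; rewrite ffunE perm1.
by apply/ffunP=> i; rewrite !ffunE permM.
Qed.

End PermutedDiagrams.

(** * Absorption of Young subgroups by the symmetrizers *)

Section Symmetrizer.
Variables (F : fieldType) (x : F) (r k : nat) (a : wcomp r k).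
Implicit Types (s u : 'S_r).

(** [young a] is a bare set; this lemma and the next two supply the closure properties used to
    reindex the symmetrizer. *)
Lemma youngM s u : s \in young a -> ((s * u)%g \in young a) = (u \in young a).
Proof.
rewrite !inE => /forallP Hs; apply/forallP/forallP => H i.
  by rewrite -(permKV s i) -permM (eqP (H _)) (eqP (Hs _)).
by rewrite permM (eqP (H _)) (eqP (Hs _)).
Qed.

Lemma youngV s : s \in young a -> (s^-1)%g \in young a.
Proof.
rewrite !inE => /forallP Hs; apply/forallP => i.
by rewrite -(eqP (Hs _)) permKV.
Qed.

Lemma youngMr s u : u \in young a -> ((s * u)%g \in young a) = (s \in young a).
Proof.
move=> yu; apply/idP/idP=> [ysu|/youngM->//].
suff <- : (s * u * u^-1)%g = s by rewrite youngM // youngV.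
by rewrite mulgK.
Qed.

(** Multiplication by L_s translates the index of the sum within [young a], on the left because of
    the order in [perm_diagramM]. *)
Lemma symz_perm s : s \in young a ->
  symz x a * diag x (perm_diagram s) = symz x a.
Proof.
move=> ys; rewrite /symz -scalerAl mulr_suml; congr (_ *: _).
rewrite [RHS](reindex_inj (mulgI s)) /=; apply: eq_big => u; first by rewrite youngM.
by rewrite perm_diagramM.
Qed.

Lemma perm_symz s : s \in young a ->
  diag x (perm_diagram s) * symz x a = symz x a.
Proof.
move=> ys; rewrite /symz -scalerAr mulr_sumr; congr (_ *: _).
rewrite [RHS](reindex_inj (mulIg s)) /=; apply: eq_big => u; first by rewrite youngMr.
by rewrite perm_diagramM.
Qed.

End Symmetrizer.

(** * Diagrams with the same image under [kappa] differ by Young permutations *)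

(** Equal fibre sizes make the two lists of values rearrangements of each other. *)
Lemma perm_of_fibers (T : eqType) n (f f' : 'I_n -> T) :
  (forall y, \sum_i (f i == y) = \sum_i (f' i == y))%N ->
  exists s : 'S_n, forall i, f' (s i) = f i.
Proof.
move=> H; have /tuple_permP[s E] : perm_eq [tuple f i | i < n] [tuple f' i | i < n].
  apply/allP=> y _ /=; apply/eqP.
  rewrite !count_map -!enumT -!sum1_count big_mkcond [RHS]big_mkcond !big_enum /=.
  exact: H.
have fE i : nth (f i) [tuple f i | i < n] i = f i by rewrite -tnth_nth tnth_mktuple.
by exists s => i; rewrite -[RHS]fE E -tnth_nth !tnth_mktuple.
Qed.

Section Recolouring.
Local Open Scope mset_scope.
Variables (r k : nat) (a b : wcomp r k).
Implicit Types (p q : setpart r) (B : {set vtx 2 r}).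

Definition recolor_block B : {mset vtx 2 k} := seq_mset [seq recolor a b v | v <- enum B].

Lemma recolor_blockE B c : recolor_block B c = (\sum_(v in B) (recolor a b v == c))%N.
Proof.
rewrite mset_seqE count_map -sum1_count big_mkcond big_enum /=.
by apply: eq_bigr => v _; case: eqP.
Qed.

Lemma row_sum (P : pred (vtx 2 r)) l c :
  (\sum_(v | P v) (recolor a b v == (l, c)) =
   \sum_(i < r) (P (l, i) && ((recolor a b (l, i)).2 == c)))%N.
Proof.
rewrite big_mkcond (eq_bigr (fun v => (P (v.1, v.2) && (recolor a b v == (l, c)) : nat))) /=; last first.
  by case=> l' i _ /=; case: (P _).
rewrite -(pair_bigA _ (fun l' i => (P (l', i) && (recolor a b (l', i) == (l, c)) : nat))) /=.
rewrite (bigD1 l) //= [X in (_ + X)%N]big1 ?addn0 => [|l' /negbTE nl].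
  by apply: eq_bigr => i _; rewrite xpair_eqE eqxx.
by apply: big1 => i _; rewrite xpair_eqE nl andbF.
Qed.

Lemma big_setpart (p : setpart r) (E : vtx 2 r -> nat) :
  (\sum_(B in sp_blocks p) \sum_(v in B) E v = \sum_v E v)%N.
Proof.
have [/eqP cp tp _] := and3P (sp_partition p).
by rewrite -(big_trivIset _ tp) cp; apply: eq_bigl => v; rewrite inE.
Qed.

(** By [count_interval], colour j is used once for each index of the j-th interval. This recovers a
    and b where [dbasis] and [obasis] read them off the multiset partition. *)
Lemma mult_kappa l p : mult l (kappa a b p) = if l == 0 then a else b.
Proof.
apply/val_inj/eq_from_tnth => j; apply/val_inj; rewrite /= tnth_mktuple inordK ?mult_le //.
rewrite msumE big_seq_mset big_map big_enum /=.
under eq_bigr => B _ do rewrite -/(recolor_block B) recolor_blockE.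
rewrite big_setpart row_sum -count_interval count_map -sum1_count [RHS]big_mkcond big_enum /=.
by apply: eq_bigr => i _; case: eqP.
Qed.

Section IndexedBlocks.
Variables (p : setpart r) (e : seq {set vtx 2 r}).
Hypothesis ep : perm_eq e (enum (sp_blocks p)).

Lemma mem_indexed_block j v : (j < size e)%N ->
  (v \in nth set0 e j) = (index (pblock p v) e == j).
Proof.
move=> je; have [/eqP cp tp _] := and3P (sp_partition p).
have ue : uniq e by rewrite (perm_uniq ep) enum_uniq.
have Bp : nth set0 e j \in sp_blocks p by rewrite -mem_enum -(perm_mem ep) mem_nth.
apply/idP/eqP=> [vB|<-]; first by rewrite (def_pblock tp Bp vB) index_uniq.
have vp : v \in cover p by rewrite cp inE.
by rewrite nth_index ?mem_pblock // (perm_mem ep) mem_enum pblock_mem.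
Qed.

Lemma index_pblock_lt v : (index (pblock p v) e < size e)%N.
Proof.
have [/eqP cp _ _] := and3P (sp_partition p).
by rewrite index_mem (perm_mem ep) mem_enum pblock_mem // cp inE.
Qed.

(** Vertices are coloured by block position and interval; positions keep apart blocks with equal
    recolourings. The fibre sizes depend only on the list of recoloured blocks. *)
Lemma count_indexed_block l j c :
  (\sum_(i < r) ((index (pblock p (l, i)) e, (recolor a b (l, i)).2) == (j, c)) =
   nth mset0 [seq recolor_block B | B <- e] j (l, c))%N.
Proof.
have [je|ej] := ltnP j (size e).
  rewrite (nth_map set0) // recolor_blockE row_sum.
  by apply: eq_bigr => i _; rewrite xpair_eqE mem_indexed_block.
(* Past the last block the default [mset0] gives 0, and no vertex has such a position. *)
rewrite nth_default ?size_map // mset0E big1 // => i _; rewrite xpair_eqE.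
by rewrite ltn_eqF // (leq_trans (index_pblock_lt _)).
Qed.

End IndexedBlocks.

(** The blocks of q can be listed so that the j-th ones of p and q have equal recolourings. Row by
    row, [perm_of_fibers] then yields permutations that preserve intervals and carry each block of p
    to the block of q in the same position. *)
Lemma kappa_eq_permute p q : kappa a b p = kappa a b q ->
  exists s u, [/\ s \in young a, u \in young b & q = permute (row_perm s u) p].
Proof.
move/(congr1 (@mp_blocks _ _ _))/eq_seq_msetP=> /(perm_iotaP mset0)[I IE pE].
pose e := [seq nth set0 (enum (sp_blocks q)) i | i <- I].
have eq_e : perm_eq e (enum (sp_blocks q)).
  rewrite -[X in perm_eq _ X](mkseq_nth set0) /mkseq /e.
  by apply: perm_map; rewrite (perm_trans IE) // size_map.
have mapE : [seq recolor_block B | B <- enum (sp_blocks p)] = [seq recolor_block B | B <- e].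
  rewrite /e -map_comp pE; apply/eq_in_map => i; rewrite (perm_mem IE) mem_iota add0n size_map.
  by move=> /andP[_ hi]; rewrite (nth_map set0).
have sizeE : size (enum (sp_blocks p)) = size e.
  by have := congr1 size mapE; rewrite !size_map.
have ep := perm_refl (enum (sp_blocks p)).
have rowP l : exists s : 'S_r, forall i,
    (index (pblock q (l, s i)) e, (recolor a b (l, s i)).2) =
    (index (pblock p (l, i)) (enum (sp_blocks p)), (recolor a b (l, i)).2).
  have := @perm_of_fibers _ _
    (fun i => (index (pblock p (l, i)) (enum (sp_blocks p)), (recolor a b (l, i)).2))
    (fun i => (index (pblock q (l, i)) e, (recolor a b (l, i)).2)).
  apply=> -[j c].
  by rewrite !count_indexed_block // mapE.
have [s sE] := rowP 0; have [u uE] := rowP 1; exists s, u; split.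
- by rewrite inE; apply/forallP=> i; apply/eqP; apply: (congr1 snd (sE i)).
- by rewrite inE; apply/forallP=> i; apply/eqP; apply: (congr1 snd (uE i)).
have gE v : index (pblock q (row_perm s u v)) e = index (pblock p v) (enum (sp_blocks p)).
  case: v => l i; rewrite permE /=.
  by case: (ord2P l) => ->; [apply: (congr1 fst (sE i))|apply: (congr1 fst (uE i))].
(* The numbers of blocks agree, so one inclusion suffices. *)
apply/esym/val_inj/eqP; rewrite /= eqEcard; apply/andP; split; last first.
  rewrite card_imset; last exact/imset_inj/perm_inj.
  by rewrite !cardE sizeE (perm_size eq_e).
apply/subsetP=> _ /imsetP[B hB ->].
have Be : B \in enum (sp_blocks p) by rewrite mem_enum.
pose j := index B (enum (sp_blocks p)).
have jp : (j < size (enum (sp_blocks p)))%N by rewrite index_mem.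
have je : (j < size e)%N by rewrite -sizeE.
suff -> : row_perm s u @: B = nth set0 e j by rewrite -mem_enum -(perm_mem eq_e) mem_nth.
apply/setP=> v; rewrite -[v](permKV (row_perm s u)) (mem_imset _ _ perm_inj).
rewrite (mem_indexed_block eq_e) // gE -(mem_indexed_block ep) //.
by rewrite nth_index.
Qed.

(** * Compatibility of [kappa] with coarsening *)

Lemma msum_recolor (A : {set {set vtx 2 r}}) : trivIset A ->
  msum (seq_mset [seq recolor_block B | B <- enum A]) = recolor_block (cover A).
Proof.
move=> tA; apply/msetP=> c.
rewrite msumE big_seq_mset big_map big_enum /= recolor_blockE (big_trivIset _ tA) /=.
by apply: eq_bigr => B _; rewrite recolor_blockE.
Qed.

(** Recolouring the blocks inside each group gives the required multiset of groups, since by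
    [msum_recolor] recolouring turns disjoint unions into multiset unions. *)
Lemma mcoarser_kappa q p : coarser q p -> mcoarser (kappa a b q) (kappa a b p).
Proof.
case/existsP=> G /andP[Gp /eqP qE]; apply/asboolP.
have [/eqP cG tG G0] := and3P Gp.
have [_ tp _] := and3P (sp_partition p).
have [_ cover_inj] := partition_partition (sp_partition p) Gp.
pose group (A : {set {set vtx 2 r}}) := seq_mset [seq recolor_block B | B <- enum A].
exists (seq_mset [seq group A | A <- enum G]); split.
- rewrite (perm_mem (perm_eq_seq_mset _)); apply: contra G0 => /mapP[A].
  rewrite mem_enum => hA /esym/eqP.
  rewrite -size_mset_eq0 (perm_size (perm_eq_seq_mset _)) size_map -cardE cards_eq0.
  by move=> /eqP <-.
- apply/msetP=> C; rewrite msumE big_seq_mset big_map big_enum /=.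
  rewrite mset_seqE count_map -sum1_count [RHS]big_mkcond big_enum /= -cG (big_trivIset _ tG) /=.
  apply: eq_bigr => A _; rewrite mset_seqE count_map -sum1_count big_mkcond big_enum /=.
  exact: eq_bigr.
(* Distinct groups have distinct unions, so the blocks of q match the groups one to one and
   multiplicities are preserved. *)
have Eq : perm_eq (enum (sp_blocks q)) [seq cover A | A <- enum G].
  apply: uniq_perm; rewrite ?enum_uniq //.
    by rewrite map_inj_in_uniq ?enum_uniq // => A A'; rewrite !mem_enum; exact: cover_inj.
  move=> B; rewrite mem_enum qE; apply/imsetP/mapP=> -[A hA ->]; exists A => //.
    by rewrite mem_enum.
  by rewrite mem_enum in hA.
apply/eq_seq_msetP; rewrite perm_sym.
apply: perm_trans (perm_map _ (perm_eq_seq_mset _)) _; rewrite perm_sym.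
apply: perm_trans (perm_map _ Eq) _; rewrite -!map_comp.
suff -> : [seq (@msum _ \o group) A | A <- enum G] =
          [seq (recolor_block \o cover) A | A <- enum G] by [].
apply/eq_in_map => A; rewrite mem_enum => hA /=; rewrite msum_recolor //.
by apply: trivIsetS tp; rewrite -cG; apply: (bigcup_sup A).
Qed.

End Recolouring.

(** * Expansion of the diagram-like basis in the orbit-like basis *)

Lemma mul_absorb (A : pzRingType) (e s f u e' : A) :
  e * s = e -> u * e' = e' -> e * (s * f * u) * e' = e * f * e'.
Proof. by move=> es ue; rewrite !mulrA es -!mulrA ue. Qed.

Section Corners.
Variables (F : fieldType) (x : F) (r k : nat).
Implicit Types (a b : wcomp r k) (p q : setpart r).

Lemma symz_diag a b p q : kappa a b p = kappa a b q ->
  symz x a * diag x p * symz x b = symz x a * diag x q * symz x b.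
Proof.
case/kappa_eq_permute=> s [u [ys yu ->]].
rewrite diag_permute; apply/esym/mul_absorb; first exact: symz_perm.
by apply: perm_symz; exact: youngV.
Qed.

Lemma symz_orbit a b p q : kappa a b p = kappa a b q ->
  symz x a * Defs.orbit x p * symz x b = symz x a * Defs.orbit x q * symz x b.
Proof.
case/kappa_eq_permute=> s [u [ys yu ->]].
rewrite orbit_permute; apply/esym/mul_absorb; first exact: symz_perm.
by apply: perm_symz; exact: youngV.
Qed.

Lemma eq_summand a b (f g : palg x r) :
  symz x a * f * symz x b = symz x a * g * symz x b -> summand a b f = summand a b g.
Proof. by move=> E; apply/val_inj/ffunP=> ab; rewrite !ffunE E. Qed.

Lemma kappa_rep (M : mpart 2 r k) : kappa (mult 0 M) (mult 1 M) (rep M) = M.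
Proof. exact: eqP (xchooseP (kappa_surj M)). Qed.

Lemma dbasis_kappa a b p : dbasis x (kappa a b p) = summand a b (diag x p).
Proof.
have Ep := kappa_rep (kappa a b p); rewrite /dbasis.
(* The chosen representative and p now have the same image under [kappa a b]. *)
rewrite !mult_kappa /= in Ep *.
by apply/eq_summand/symz_diag.
Qed.

Lemma obasis_kappa a b p : obasis x (kappa a b p) = summand a b (Defs.orbit x p).
Proof.
have Ep := kappa_rep (kappa a b p); rewrite /obasis.
rewrite !mult_kappa /= in Ep *.
by apply/eq_summand/symz_orbit.
Qed.

Lemma summand_sum a b (I : finType) (P : pred I) (f : I -> palg x r) :
  summand a b (\sum_(i | P i) f i) = \sum_(i | P i) summand a b (f i).
Proof.
have H0 : summand a b (0 : palg x r) = 0.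
  by apply/val_inj/ffunP=> ab; rewrite !ffunE mulr0 mul0r if_same.
have HD : {morph summand a b : f g / f + g :> palg x r >-> f + g}.
  move=> f1 f2; apply/val_inj/ffunP=> ab; rewrite !ffunE mulrDr mulrDl.
  by case: eqP => //; rewrite addr0.
exact: (big_morph _ HD H0).
Qed.

Lemma dbasis_obasis a b p :
  dbasis x (kappa a b p) = \sum_(q | coarser q p) obasis x (kappa a b q).
Proof.
rewrite dbasis_kappa diag_orbit summand_sum.
by apply: eq_bigr => q _; rewrite obasis_kappa.
Qed.

(** The sum over coarsenings q of p is split by the value N of [kappa a b q], which lies in the
    stated range by [mcoarser_kappa]; each class is constant and has [coef_c a b N p] members. *)
Lemma dbasis_obasis_coef a b p :
  dbasis x (kappa a b p) = \sum_(N | mcoarser N (kappa a b p))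
    (coef_c a b N p)%:R *: obasis x N.
Proof.
rewrite dbasis_obasis (partition_big (kappa a b) (fun N => mcoarser N (kappa a b p))) /=; last first.
  by move=> q; exact: mcoarser_kappa.
apply: eq_bigr => N _; rewrite (eq_bigr (fun=> obasis x N)) => [|q /andP[_ /eqP->] //].
by rewrite sumr_const scaler_nat /coef_c cardsE.
Qed.

End Corners.

Theorem mainTheorem7 (R : realType) (r k : nat) (r_gt0 : (0 < r)%N) (k_gt0 : (0 < k)%N)
    (phi : {linear ptilde (indet R) r k -> mpalg (indet R) r k})
    (phi_iso : alg_iso phi)
    (phi_obasis : forall N : mpart 2 r k,
       phi (obasis (indet R) N) = omega (ratfun R) N *: xbasis (indet R) N)
    (M : mpart 2 r k) (a b : wcomp r k) (ha : mult 0 M = a) (hb : mult 1 M = b)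
    (p : setpart r) (hp : kappa a b p = M) :
  phi (dbasis (indet R) M) =
    \sum_(N : mpart 2 r k | mcoarser N M)
      ((coef_c a b N p)%:R * omega (ratfun R) N) *: xbasis (indet R) N.
Proof.
rewrite -hp dbasis_obasis_coef linear_sum; apply: eq_bigr => N _.
by rewrite linearZZ phi_obasis scalerA.
Qed.
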